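(* Let $p$ be a prime, $q=p^h$, $c\in\mathbb{F}_q$, and let $d$ be a positive integer with $p\nmid d(d-1)$. Let $s$ be the smallest positive integer such that $(d-1)\mid(p^s-1)$. Suppose that a $(d-1)$-th root $c_0\in\overline{\mathbb{F}_q}$ of $c$ does not lie in $\mathbb{F}_{p^s}$. Then the plane curve $$\mathcal{C}_{f,c}:\ \frac{(X+1)^d-(Y+1)^d-c\,(X^d-Y^d)}{X-Y}=0$$ is absolutely irreducible.
   Context: Since $\mathbb{F}_{p^s}$ contains all $(d-1)$-th roots of unity, the condition on $c_0$ does not depend on the choice of the $(d-1)$-th root of $c$. *)

(* Defs.v *)
From mathcomp Require Import all_boot all_algebra all_field.
From mathcomp.multinomials Require Import mpoly.

Set Implicit Arguments.
Unset Strict Implicit.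
Unset Printing Implicit Defensive.

Import GRing.Theory.
Local Open Scope ring_scope.

Definition irreducible_elt (R : idomainType) (a : R) : Prop :=
  [/\ a != 0, a \isn't a GRing.unit &
      forall x y : R, a = x * y -> x \is a GRing.unit \/ y \is a GRing.unit].

Definition algebraic_closure (F : fieldType) (K : closedFieldType)
    (iota : {rmorphism F -> K}) : Prop :=
  integralRange iota.

(* iota is meant to be an algebraic closure of F. *)
Definition absolutely_irreducible (F : fieldType) (K : closedFieldType)
    (iota : {rmorphism F -> K}) (n : nat) (P : {mpoly F[n]}) : Prop :=
  irreducible_elt (map_mpoly iota P).

Definition curve_num (F : fieldType) (d : nat) (c : F) : {mpoly F[2]} :=
  let X := 'X_(0 : 'I_2) in
  let Y := 'X_(1 : 'I_2) in
  (X + 1) ^+ d - (Y + 1) ^+ d - c *: (X ^+ d - Y ^+ d).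

(* P is the quotient of curve_num d c by X - Y. *)
Definition curve_eq (F : fieldType) (d : nat) (c : F) (P : {mpoly F[2]}) : Prop :=
  P * ('X_(0 : 'I_2) - 'X_(1 : 'I_2)) = curve_num d c.

Lemma curve_eq_exists_unique (F : fieldType) (d : nat) (c : F) :
  exists! P : {mpoly F[2]}, curve_eq d c P.
Proof.
pose S (x y : {mpoly F[2]}) := \sum_(i < d) x ^+ (d.-1 - i) * y ^+ i.
exists (S ('X_(0 : 'I_2) + 1) ('X_(1 : 'I_2) + 1)
        - c *: S 'X_(0 : 'I_2) 'X_(1 : 'I_2)).
split.
  rewrite /curve_eq /curve_num !subrXX opprD addrACA subrr addr0.
  by rewrite mulrC mulrBr scalerAr.
have nz : 'X_(0 : 'I_2) - 'X_(1 : 'I_2) != 0 :> {mpoly F[2]}.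
  apply/eqP => /(congr1 (mcoeff U_(0 : 'I_2))) /eqP.
  by rewrite mcoeffB !mcoeffX mcoeff0 !eq_mnm1 subr0 oner_eq0.
move=> Q; rewrite /curve_eq => hQ; apply: (mulIf nz); rewrite hQ.
rewrite /curve_num !subrXX opprD addrACA subrr addr0.
by rewrite mulrC mulrBr scalerAr.
Qed.

(* Main.v *)
(* With g = (X+1)^d - c X^d the curve P is (g(X) - g(Y)) / (X - Y), and c <> 1
   since 1 has all its (d-1)-th roots in F_{p^s}; so g has degree d. A singular
   point (x, y) of P has g'(x) = g'(y) = 0 and g(x) = g(y). The critical points
   satisfy (x+1)^(d-1) = c x^(d-1), with critical value c x^(d-1); two of them
   with equal value satisfy y = a x and y + 1 = b (x + 1) with a, b roots of
   unity in F_{p^s}, and if x <> y then x, and hence c0, lies in F_{p^s}. So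
   x = y, where P is smooth because the roots of g' are simple: g is a Morse
   polynomial.
   If P = A B, then A and B have no common zero, as it would be singular on P,
   hence u A + v B = 1 for some u, v. But the top form of P divides
   X^d - Y^d, which is squarefree, so the top forms of A and B are coprime.
   This allows to lower the degrees of u and v indefinitely, unless A or B is
   constant. *)

Require Import Defs.
From mathcomp Require Import all_boot all_algebra all_field.
From mathcomp.multinomials Require Import mpoly.
From mathcomp Require Import ring zify.

Set Implicit Arguments.
Unset Strict Implicit.
Unset Printing Implicit Defensive.

Import GRing.Theory.
Local Open Scope ring_scope.

(** * Ideals of polynomials and zeros in a finite grid *)

Definition is_ideal (R : comNzRingType) (I : R -> Prop) : Prop :=
  [/\ I 0, forall f g, I f -> I g -> I (f + g) & forall r f, I f -> I (r * f)].

(** Stands for the ideal I + (h); thus [add_gen I h 1] says that h is invertible modulo I. *)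
Definition add_gen (R : comNzRingType) (I : R -> Prop) (h f : R) : Prop :=
  exists w, I (f - w * h).

Lemma add_gen_ideal (R : comNzRingType) (I : R -> Prop) h :
  is_ideal I -> is_ideal (add_gen I h).
Proof.
case=> I0 ID IM; split.
- by exists 0; rewrite mul0r subr0.
- move=> f g [u If] [v Ig]; exists (u + v).
  by rewrite mulrDl opprD addrACA; apply: (ID).
- by move=> r f [u If]; exists (r * u); rewrite -mulrA -mulrBr; apply: (IM).
Qed.

Lemma add_gen_sub (R : comNzRingType) (I : R -> Prop) h f :
  I f -> add_gen I h f.
Proof. by exists 0; rewrite mul0r subr0. Qed.

Lemma add_gen_mem (R : comNzRingType) (I : R -> Prop) h :
  is_ideal I -> add_gen I h h.
Proof. by case=> I0 _ _; exists 1; rewrite mul1r subrr. Qed.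

(** A product of elements invertible modulo [I] is invertible modulo [I]; as it also lies in [I], so
    does 1. *)
Lemma ideal_prod1 (R : comNzRingType) (I : R -> Prop) (T : eqType)
    (s : seq T) (h : T -> R) :
  is_ideal I -> I (\prod_(r <- s) h r) ->
  (forall r, r \in s -> add_gen I (h r) 1) -> I 1.
Proof.
move=> [I0 ID IM] Is Icom.
suff [w Iw] : add_gen I (\prod_(r <- s) h r) 1.
  by rewrite -(subrK (w * \prod_(r <- s) h r) 1); apply: (ID) => //; apply: (IM).
elim: s {Is} Icom => [|r s IHs] Icom.
  by exists 1; rewrite big_nil mulr1 subrr.
have [u Iu] : add_gen I (h r) 1 by apply: Icom; rewrite mem_head.
have [|v Iv] := IHs; first by move=> x xs; apply: Icom; rewrite inE xs orbT.
exists (u * v); rewrite big_cons; set H := \prod_(_ <- _) _.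
have -> : 1 - u * v * (h r * H) = (1 - u * h r) + (u * h r) * (1 - v * H).
  by ring.
by apply: (ID) => //; apply: (IM).
Qed.

(** The polynomials congruent to their value at [v] are closed under sums and products, and they
    include the constants and the variables. *)
Lemma ideal_subr_meval (R : comNzRingType) (n : nat)
    (I : {mpoly R[n]} -> Prop) (v : 'I_n -> R) (f : {mpoly R[n]}) :
  is_ideal I -> (forall i, I ('X_i - (v i)%:MP)) -> I (f - (meval v f)%:MP).
Proof.
move=> [I0 ID IM] IX.
pose C f := I (f - (meval v f)%:MP).
have CD g h : C g -> C h -> C (g + h).
  by move=> Cg Ch; rewrite /C mevalD mpolyCD opprD addrACA; apply: (ID).
have CM g h : C g -> C h -> C (g * h).
  move=> Cg Ch; rewrite /C mevalM mpolyCM.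
  have -> : g * h - (meval v g)%:MP * (meval v h)%:MP =
    h * (g - (meval v g)%:MP) + (meval v g)%:MP * (h - (meval v h)%:MP).
    by ring.
  by apply: (ID); apply: (IM).
have CC c : C c%:MP by rewrite /C mevalC subrr.
have C1 : C 1 by rewrite -mpolyC1.
elim/mpolyind: f => [|c m f _ _ Cf]; first by rewrite -mpolyC0; apply: CC.
apply: CD => //; rewrite -mul_mpolyC; apply: (CM) => //.
rewrite mpolyXE_id; elim/big_rec: _ => // i g _ Cg; apply: (CM) => //.
elim: (m i) => [|k IHk]; rewrite ?expr0 // exprS; apply: (CM) => //.
by rewrite /C mevalXU.
Qed.

(* The zeros lie in the finite grid s x s, so this case of the weak
   Nullstellensatz follows from the comaximality of distinct points. *)
Lemma ideal_grid1 (K : fieldType) (I : {mpoly K[2]} -> Prop) (s : seq K) :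
  is_ideal I ->
  (forall i : 'I_2, I (\prod_(r <- s) ('X_i - r%:MP))) ->
  (forall v : 'I_2 -> K, (forall i, v i \in s) ->
     exists2 f, I f & meval v f != 0) ->
  I 1.
Proof.
move=> idI Is sep.
apply: (ideal_prod1 idI (Is 0)) => x xs.
have idIx := add_gen_ideal ('X_0 - x%:MP) idI.
apply: (ideal_prod1 idIx (add_gen_sub _ (Is 1))) => y ys.
set J := add_gen _ _.
have idJ : is_ideal J by apply: add_gen_ideal.
pose v (i : 'I_2) := if i == 0 then x else y.
have [|f If fv] := sep v; first by move=> i; rewrite /v; case: ifP.
have JX i : J ('X_i - (v i)%:MP).
  rewrite /v; case: eqP => [->|/eqP ni]; first exact/add_gen_sub/add_gen_mem.
  have -> : i = 1 by case: i ni => [[|[|]]] // ? ?; apply: val_inj.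
  exact: add_gen_mem.
have Jf : J f by do 2! apply: add_gen_sub.
have := ideal_subr_meval f idJ JX; case: idJ => _ JD JM Jfv.
have -> : 1 = (meval v f)^-1%:MP * (f + (-1) * (f - (meval v f)%:MP)).
  by rewrite mulN1r opprB addrC subrK -mpolyCM mulVf.
by apply: (JM); apply: JD => //; apply: (JM).
Qed.

(** * Degrees and top forms of bivariate polynomials *)

(* X |-> t y, Y |-> y, with t the inner and y the outer variable: the y-degree
   is the total degree and the leading coefficient is the dehomogenized top
   form. *)
Definition cone (K : fieldType) : {rmorphism {mpoly K[2]} -> {poly {poly K}}} :=
  mmap (polyC \o polyC) (fun i : 'I_2 => if i == 0 then 'X%:P * 'X else 'X).

(** X^i Y^j goes to t^i y^(i+j), so distinct monomials stay apart. *)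
Lemma cone_coef (K : fieldType) (P : {mpoly K[2]}) (m : 'X_{1..2}) :
  (cone K P)`_(m 0 + m 1)`_(m 0) = P@_m.
Proof.
elim/mpolyind: P => [|c k P _ _ IHP]; first by rewrite raddf0 !coef0 mcoeff0.
rewrite rmorphD /= !coefD IHP mcoeffD mcoeffZ mcoeffX; congr (_ + _).
rewrite /cone mmapZ mmapX /mmap1 big_ord_recl big_ord1 /= exprMn.
rewrite -mulrA -exprD -rmorphXn /= !coefCM coefXn.
have -> : lift ord0 ord0 = 1 :> 'I_2 by apply: val_inj.
have -> : (k == m) = (k 0 == m 0) && (k 1 == m 1).
  apply/eqP/andP => [->|[/eqP e0 /eqP e1]]; first by rewrite !eqxx.
  by apply/mnmP => -[[|[|]]] // i; [move: e0|move: e1];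
    congr (_ = _); congr (fun_of_multinom _ _); apply: val_inj.
rewrite -[ord0]/(0 : 'I_2) mulr_natr coefMn coefXn.
rewrite (eq_sym (k 0)) (eq_sym (k 1)).
have [->|ne] := eqVneq (m 0) (k 0).
  by rewrite eqn_add2l.
by rewrite mul0rn.
Qed.

Lemma cone_inj (K : fieldType) : injective (cone K).
Proof. by move=> P Q e; apply/mpolyP => m; rewrite -!cone_coef e. Qed.

(** Describes the image of [cone]: t^i y^k comes from X^i Y^(k-i), which needs i <= k. *)
Definition in_cone (K : fieldType) (f : {poly {poly K}}) : Prop :=
  forall k, (size (f`_k)%R <= k.+1)%N.

Lemma in_coneD (K : fieldType) (f g : {poly {poly K}}) :
  in_cone f -> in_cone g -> in_cone (f + g).
Proof.
move=> cf cg k; rewrite coefD (leq_trans (size_polyD _ _)) // geq_max.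
by rewrite cf cg.
Qed.

Lemma in_coneM (K : fieldType) (f g : {poly {poly K}}) :
  in_cone f -> in_cone g -> in_cone (f * g).
Proof.
move=> cf cg k; rewrite coefM; apply: (leq_trans (size_sum _ _ _)).
apply/bigmax_leqP => i _; apply: (leq_trans (size_polyMleq _ _)).
have := leq_add (cf i) (cg (k - i)%N).
rewrite addSn addnS subnKC -1?ltnS //.
by case: (size _ + _)%N.
Qed.

Lemma in_coneXn (K : fieldType) (w : {poly K}) (k : nat) :
  (size w <= k.+1)%N -> in_cone (w%:P * 'X^k).
Proof.
move=> sw j; rewrite coefCM coefXn; case: eqP => [->|_]; rewrite ?mulr1 //.
by rewrite mulr0 size_poly0.
Qed.

Lemma in_cone_cone (K : fieldType) (P : {mpoly K[2]}) : in_cone (cone K P).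
Proof.
have C0 (c : K) : in_cone (c%:P%:P).
  have := @in_coneXn K c%:P 0; rewrite expr0 mulr1; apply.
  by rewrite size_polyC_leq1.
elim/mpolyind: P => [|c m P _ _ IHP]; first by rewrite rmorph0 -2!polyC0.
rewrite rmorphD; apply: in_coneD => //; rewrite /cone /= mmapZ.
apply: in_coneM; first exact: C0.
rewrite mmapX /mmap1; elim/big_rec: _ => [|i f _ cf]; first by rewrite -2!polyC1.
apply: in_coneM => //; elim: (m i) => [|k IHk]; first by rewrite expr0 -2!polyC1.
rewrite exprS; apply: in_coneM => //.
case: eqP => _; first by apply: (@in_coneXn _ 'X 1); rewrite size_polyX.
by rewrite -['X]mul1r -polyC1; apply: (@in_coneXn _ 1 1); rewrite size_poly1.
Qed.

Lemma size_lead_coef_in_cone (K : fieldType) (f : {poly {poly K}}) :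
  in_cone f -> f != 0 -> (size (lead_coef f) <= size f)%N.
Proof.
by move=> cf f0; rewrite lead_coefE (leq_trans (cf _)) // prednK // size_poly_gt0.
Qed.

(** Equality of the sizes means that Y does not divide the top form. Degrees in t and in y both add
    up, so equality for the product forces it in the two inequalities for the factors. *)
Lemma size_lead_coef_in_coneM (K : fieldType) (a b : {poly {poly K}}) :
  in_cone a -> in_cone b -> a != 0 -> b != 0 ->
  size (lead_coef (a * b)) = size (a * b) ->
  size (lead_coef a) = size a /\ size (lead_coef b) = size b.
Proof.
move=> ca cb a0 b0; have := size_lead_coef_in_cone ca a0.
have := size_lead_coef_in_cone cb b0.
rewrite lead_coefM !size_mul ?lead_coef_eq0 //.
move: a0 b0; rewrite -!size_poly_gt0.
move: (size a) (size b) (size (lead_coef a)) (size (lead_coef b)) => k l m n.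
by lia.
Qed.

(* Two curves without common point at infinity have no Bezout relation: the
   top forms of u and v could be cancelled indefinitely. *)
Lemma cone_bezout_neq1 (K : fieldType) (a b u v : {poly {poly K}}) :
  in_cone a -> in_cone b -> in_cone u -> in_cone v ->
  coprimep (lead_coef a) (lead_coef b) ->
  size (lead_coef a) = size a -> size (lead_coef b) = size b ->
  (1 < size a)%N -> (1 < size b)%N -> u * a + v * b <> 1.
Proof.
move=> ca cb + + cop sa sb a1 b1.
have nat1 m k : (m + k)%N.-1 = 1%N -> (0 < m)%N -> ~ (1 < k)%N by lia.
have nat2 m k : (0 < m)%N -> (1 < k)%N -> (1 < (m + k).-1)%N by lia.
have nat3 m k l r : (m + k)%N.-1 = l -> (l <= r)%N -> (0 < m)%N ->
  (m <= (r - k).+1)%N /\ (k <= r)%N by lia.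
have a0 : a != 0 by rewrite -size_poly_gt0 ltnW.
have b0 : b != 0 by rewrite -size_poly_gt0 ltnW.
have [n] := ubnP (size u); elim: n u v => // n IHn u v ltn cu cv e.
have [u0|u0] := eqVneq u 0.
  have vb : v * b = 1 by rewrite -e u0 mul0r add0r.
  have v0 : v != 0.
    by apply: contra_eq_neq vb => ->; rewrite mul0r eq_sym oner_eq0.
  have : size (v * b) = 1%N by rewrite vb size_poly1.
  by rewrite size_mul // => /nat1; apply; rewrite ?size_poly_gt0.
have uaE : u * a = 1 - v * b by rewrite -e addrK.
have sua : (1 < size (u * a)%R)%N.
  by rewrite size_mul // nat2 // size_poly_gt0.
have vb0 : v * b != 0.
  apply: contraTneq sua => vb; rewrite uaE vb subr0 size_poly1 //.
have v0 : v != 0 by apply: contraNneq vb0 => ->; rewrite mul0r.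
have svb : (1 < size (v * b)%R)%N.
  rewrite ltnNge; apply: contraL sua => sle; rewrite -leqNgt uaE.
  by rewrite (leq_trans (size_polyD _ _)) // geq_max size_poly1 size_polyN.
(* Both products have positive degree in y and their sum is 1, so their leading terms cancel. *)
have lE : lead_coef u * lead_coef a = - (lead_coef v * lead_coef b).
  rewrite -!lead_coefM uaE addrC lead_coefDl ?lead_coefN //.
  by rewrite size_polyN size_poly1.
have : lead_coef b %| lead_coef u.
  rewrite -(@Gauss_dvdpl _ _ (lead_coef a)) 1?coprimep_sym //.
  by rewrite lE dvdpNr dvdp_mull.
move=> /dvdpP [w lu].
have w0 : w != 0 by apply: contraNneq u0 => w0; rewrite -lead_coef_eq0 lu w0 mul0r.
have slu : (size w + size b).-1 = size (lead_coef u).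
  by rewrite lu size_mul ?lead_coef_eq0 // sb.
have lus : (size (lead_coef u) <= size u)%N.
  by rewrite lead_coefE (leq_trans (cu _)) // prednK // size_poly_gt0.
(* Since [lead_coef b] has full degree in t, the degree of [w] is small enough for [z] below to stay
   in the cone. *)
have [sw sbu] : (size w <= (size u - size b).+1)%N /\ (size b <= size u)%N.
  by apply: nat3 slu lus _; rewrite size_poly_gt0.
pose z := w%:P * 'X^(size u - size b).
have cz : in_cone z by apply: in_coneXn.
have cN f : in_cone f -> in_cone (- f) by move=> cf k; rewrite coefN size_polyN.
(* The new cofactors satisfy the same relation, and [z * b] cancels the leading term of [u]. *)
apply: (IHn (u - z * b) (v + z * a)).
- rewrite -ltnS; apply: leq_trans ltn; rewrite ltnS.
  have szb : size (z * b) = size u.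
    rewrite /z -mulrA size_Cmul // size_monicM ?monicXn // size_polyXn addSn /=.
    by rewrite subnK.
  have lzb : lead_coef (z * b) = lead_coef u.
    by rewrite !lead_coefM lead_coefC lead_coefXn mulr1 lu.
  rewrite -(prednK (n := size u)) ?size_poly_gt0 // ltnS.
  apply/leq_sizeP => k; rewrite leq_eqVlt => /orP [/eqP <-|lt].
    by rewrite coefB -{2}szb -!lead_coefE lzb subrr.
  rewrite prednK ?size_poly_gt0 // in lt.
  by rewrite coefB !nth_default ?szb ?subrr.
- by apply: in_coneD => //; apply: cN; apply: in_coneM.
- by apply: in_coneD => //; apply: in_coneM.
- by rewrite -e; ring.
Qed.

(** * The difference g(X) - g(Y) and its quotient by X - Y *)

Definition uni (K : comNzRingType) (n : nat) (i : 'I_n) :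
  {rmorphism {poly K} -> {mpoly K[n]}} := horner_alg 'X_i.
Arguments uni {K n} i.

Lemma uniC (K : comNzRingType) (n : nat) (i : 'I_n) (a : K) :
  uni i a%:P = a%:MP.
Proof. by rewrite /uni /= horner_algC -mul_mpolyC mulr1. Qed.

Lemma uniX (K : comNzRingType) (n : nat) (i : 'I_n) :
  uni i 'X = 'X_i :> {mpoly K[n]}.
Proof. by rewrite /uni /= horner_algX. Qed.

Lemma meval_uni (K : comNzRingType) (n : nat) (i : 'I_n)
    (v : 'I_n -> K) (g : {poly K}) :
  meval v (uni i g) = g.[v i].
Proof.
elim/poly_ind: g => [|g a IHg]; first by rewrite rmorph0 meval0 horner0.
rewrite hornerMXaddC rmorphD rmorphM /= mevalD mevalM IHg.
by rewrite uniX uniC mevalXU mevalC.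
Qed.

Lemma mderiv_uni (K : comNzRingType) (n : nat) (i j : 'I_n) (g : {poly K}) :
  mderiv i (uni j g) = if i == j then uni j g^`() else 0.
Proof.
elim/poly_ind: g => [|g a IHg].
  by rewrite deriv0 rmorph0 mderiv0 if_same.
rewrite rmorphD rmorphM /= uniX uniC mderivD mderivM mderivC IHg addr0.
rewrite mderivX mnm1E eq_sym derivMXaddC rmorphD rmorphM /= uniX addrC.
case: eqP => [->|_]; last by rewrite scale0r mulr0 mul0r addr0.
have U0 k : (U_(k) - U_(k) = 0 :> 'X_{1..n})%MM.
  by apply/mnmP=> l; rewrite mnmBE subnn mnm0E.
by rewrite scale1r U0 mpolyX0 mulr1.
Qed.

(** Each X^k - Y^k becomes (t^k - 1) y^k. *)
Lemma cone_uni_sub (K : fieldType) (g : {poly K}) :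
  cone K (uni 0 g - uni 1 g) = \poly_(k < size g) (g`_k *: ('X^k - 1)).
Proof.
have coneC a : cone K a%:MP = a%:P%:P by rewrite /cone /= mmapC.
have cone0 : cone K 'X_0 = 'X%:P * 'X by rewrite /cone /= mmapX mmap1U.
have cone1 : cone K 'X_1 = 'X by rewrite /cone /= mmapX mmap1U.
rewrite -{1 2}[g]coefK !poly_def !rmorph_sum -sumrB rmorph_sum /=.
apply: eq_bigr => k _.
rewrite -!mul_polyC !rmorphM !rmorphXn /= !uniC !uniX -mulrBr rmorphM rmorphB /=.
rewrite !rmorphXn /= coneC cone0 cone1 exprMn -mulrA; congr (_ * _).
by rewrite polyCB polyC1 rmorphXn mulrBl mul1r.
Qed.

Lemma cone_unit (K : fieldType) (A : {mpoly K[2]}) :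
  A != 0 -> (size (cone K A) <= 1)%N -> A \is a GRing.unit.
Proof.
move=> A0 /size1_polyC sA.
have := in_cone_cone A 0; rewrite sA coefC eqxx.
move=> /size1_polyC; set a := _`_0 => ea.
have AE : A = (a`_0)%:MP.
  by apply: (@cone_inj K); rewrite {2}/cone /= mmapC /= -ea; exact: sA.
rewrite AE; apply: rmorph_unit; rewrite unitfE.
by apply: contraNneq A0 => a0; rewrite AE a0 mpolyC0.
Qed.

(** Puts g'(X) in the ideal generated by P and its partial derivatives, so that singular points have
    critical coordinates. *)
Lemma mderiv0_curve (K : comNzRingType) (g : {poly K}) (P : {mpoly K[2]}) :
  P * ('X_0 - 'X_1) = uni 0 g - uni 1 g ->
  mderiv 0 P * ('X_0 - 'X_1) + P = uni 0 g^`().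
Proof.
move=> P_curve; have := congr1 (mderiv 0) P_curve.
rewrite mderivM !mderivB !mderiv_uni -!uniX !mderiv_uni /= derivX rmorph1.
by rewrite !subr0 mulr1.
Qed.

Lemma mderiv1_curve (K : comNzRingType) (g : {poly K}) (P : {mpoly K[2]}) :
  P * ('X_0 - 'X_1) = uni 0 g - uni 1 g ->
  mderiv 1 P * ('X_0 - 'X_1) - P = - uni 1 g^`().
Proof.
move=> P_curve; have := congr1 (mderiv 1) P_curve.
rewrite mderivM !mderivB !mderiv_uni -!uniX !mderiv_uni /= derivX rmorph1.
by rewrite !sub0r mulrN1.
Qed.

Lemma cone_curve (K : fieldType) (g : {poly K}) (P : {mpoly K[2]}) :
  P * ('X_0 - 'X_1) = uni 0 g - uni 1 g ->
  cone K P * ('X%:P * 'X - 'X) =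
  \poly_(k < size g) (g`_k *: ('X^k - 1)).
Proof.
move=> P_curve; rewrite -cone_uni_sub -P_curve rmorphM rmorphB /=.
by rewrite /cone /= !mmapX !mmap1U.
Qed.

(** With D the degree of g, the top form of P is the leading coefficient of g times (X^D - Y^D) / (X
    - Y). *)
Lemma size_lead_coef_cone_curve (K : fieldType) (g : {poly K}) (P : {mpoly K[2]}) :
  P * ('X_0 - 'X_1) = uni 0 g - uni 1 g ->
  (1 < size g)%N ->
  size (cone K P) = (size g).-1 /\
  lead_coef (cone K P) * ('X - 1) = lead_coef g *: ('X^((size g).-1) - 1).
Proof.
move=> P_curve g_gt1; have g0 : (0 < size g)%N by apply: leq_trans g_gt1.
have E0 : g`_(size g).-1 *: ('X^((size g).-1) - 1) != 0 :> {poly K}.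
  rewrite -lead_coefE scaler_eq0 negb_or lead_coef_eq0 -!size_poly_gt0 g0 /=.
  by rewrite -polyC1 size_XnsubC // -ltnS prednK.
have E : ('X%:P * 'X - 'X : {poly {poly K}}) = ('X - 1)%:P * 'X.
  by rewrite polyCB polyC1 mulrBl mul1r.
have X1 : 'X - 1 != 0 :> {poly K} by rewrite -polyC1 polyXsubC_eq0.
have P0 : cone K P != 0.
  apply: contraNneq E0 => P0; move: (cone_curve P_curve); rewrite P0 mul0r.
  move=> /(congr1 (coefp (size g).-1)); rewrite /= coef0 coef_poly.
  by rewrite prednK // leqnn => <-.
split.
  have := congr1 (fun f : {poly {poly K}} => size f) (cone_curve P_curve).
  rewrite E size_poly_eq //= mulrCA size_Cmul // size_mulX //.
  by move <-.
have := congr1 lead_coef (cone_curve P_curve).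
by rewrite E !lead_coefM lead_coefC lead_coefX mulr1 lead_coef_poly.
Qed.


(** * Irreducibility for Morse polynomials *)

(** The last two hypotheses ask for simple critical points and distinct critical values; the one on
    the degree makes t^D - 1 separable, which controls the points at infinity. *)
Lemma morse_irreducible (K : closedFieldType) (g : {poly K})
    (P : {mpoly K[2]}) :
  P * ('X_0 - 'X_1) = uni 0 g - uni 1 g ->
  (2 < size g)%N -> (size g).-1%:R != 0 :> K ->
  (forall x, root g^`() x -> ~~ root g^`()^`() x) ->
  (forall x y, root g^`() x -> root g^`() y -> g.[x] = g.[y] -> x = y) ->
  irreducible_elt P.
Proof.
move=> P_curve g2 deg_neq0 simple_crit crit_inj.
have [sP lP] := size_lead_coef_cone_curve P_curve (ltnW g2).
have P0 : P != 0.
  apply/eqP=> P0; move: sP g2; rewrite P0 rmorph0 size_poly0.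
  by case: (size g) => [|[|[]]].
split=> // [|A B PE].
  apply/negP=> /(rmorph_unit (cone K)); rewrite poly_unitE sP => /andP[/eqP s1 _].
  by move: g2; case: (size g) s1 => [|[|[|]]].
have [sA|sA] := leqP (size (cone K A)) 1.
  by left; apply: cone_unit => //; apply: contraNneq P0 => A0; rewrite PE A0 mul0r.
have [sB|sB] := leqP (size (cone K B)) 1.
  by right; apply: cone_unit => //; apply: contraNneq P0 => B0; rewrite PE B0 mulr0.
exfalso.
pose I f := exists u v, f = u * A + v * B.
have idI : is_ideal I.
  split=> [|_ _ [u [v ->]] [w [z ->]]|r _ [u [v ->]]].
  - by exists 0, 0; rewrite !mul0r addr0.
  - by exists (u + w), (v + z); ring.
  - by exists (r * u), (r * v); ring.
have [_ ID IM] := idI.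
have IP : I P by exists 0, A; rewrite mul0r add0r.
have IdP i : I (mderiv i P).
  by exists (mderiv i B), (mderiv i A); rewrite PE mderivM; ring.
(* Hence the common zeros of A and B lie in the finite grid of pairs of critical points. *)
have Iuni (i : 'I_2) : I (uni i g^`()).
  case: i => [[|[|]]] // lti.
    rewrite (_ : Ordinal lti = 0); last exact: val_inj.
    rewrite -(mderiv0_curve P_curve); apply: (ID) => //.
    by rewrite mulrC; apply: (IM).
  rewrite (_ : Ordinal lti = 1); last exact: val_inj.
  rewrite -[uni 1 _]opprK -(mderiv1_curve P_curve) opprB; apply: (ID) => //.
  by rewrite -mulrN mulrC; apply: (IM).
have [s gE] := closed_field_poly_normal g^`().
(* If g' were zero, then 0 would be a critical point that is not simple. *)
have lg0 : lead_coef g^`() != 0.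
  rewrite lead_coef_eq0; apply: contraTneq isT => dg0.
  have := simple_crit 0; rewrite dg0 deriv0 root0.
  by move=> /(_ isT).
have rootE x : root g^`() x = (x \in s).
  by rewrite gE rootZ // root_prod_XsubC.
have I1 : I 1.
  apply: (ideal_grid1 (s := s)) => // [i|v vs].
    have -> : \prod_(r <- s) ('X_i - r%:MP) =
        (lead_coef g^`())^-1%:MP * uni i g^`().
      rewrite {2}gE -mul_polyC rmorphM uniC mulrA -mpolyCM mulVf // mpolyC1 mul1r.
      rewrite rmorph_prod; apply: eq_bigr => r _.
      by rewrite rmorphB /= uniC uniX.
    exact: IM.
  (* Off the diagonal P itself does not vanish: otherwise two distinct critical points would share a
     critical value. *)
  have [e|ne] := eqVneq (v 0) (v 1); last first.
    exists P => //; apply/eqP=> Pv; move/eqP: ne; apply.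
    apply: crit_inj; rewrite ?rootE //.
    have := congr1 (meval v) P_curve.
    by rewrite mevalM Pv mul0r mevalB !meval_uni => /esym/subr0_eq.
  have [Av|Av] := eqVneq (meval v A) 0; last first.
    by exists A => //; exists 1, 0; rewrite mul1r mul0r addr0.
  have [Bv|Bv] := eqVneq (meval v B) 0; last first.
    by exists B => //; exists 0, 1; rewrite mul1r mul0r add0r.
  (* A second derivation in X gives g''(x) = 2 P_X(x, x) on the diagonal, and P_X vanishes where A
     and B both do. *)
  exfalso; have := simple_crit (v 0); rewrite rootE => /(_ (vs 0)) /negP; apply.
  have := congr1 (mderiv 0) (mderiv0_curve P_curve).
  rewrite mderivD mderivM mderivB -!uniX !mderiv_uni /= derivX rmorph1 subr0 mulr1.
  move=> /(congr1 (meval v)); rewrite !mevalD mevalM mevalB !meval_uni !hornerX.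
  rewrite e subrr mulr0 add0r PE mderivM mevalD !mevalM Av Bv !mulr0 mul0r !addr0.
  by rewrite /root => <-.
have [u [v e]] := I1.
have lg : lead_coef g != 0 by rewrite lead_coef_eq0 -size_poly_gt0 (leq_trans _ g2).
have D0 : (0 < (size g).-1)%N by case: (size g) g2 => [|[]].
have slP : size (lead_coef (cone K P)) = size (cone K P).
  move: lP; rewrite sP; move: (lead_coef _) => l lE.
  have := congr1 (size \o polyseq) lE.
  have l0 : l != 0.
    apply: contra_eq_neq lE => ->; rewrite mul0r eq_sym scaler_eq0 negb_or lg.
    by rewrite -size_poly_gt0 -polyC1 size_XnsubC.
  rewrite /= size_scale // -polyC1 size_XnsubC // size_Mmonic ?monicXsubC //.
  by rewrite size_XsubC addn2 => -[].
(* The product of the two leading coefficients divides the separable polynomial t^D - 1. *)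
have lcop : coprimep (lead_coef (cone K A)) (lead_coef (cone K B)).
  apply: (separable.separable_coprime (cyclotomic.separable_Xn_sub_1 deg_neq0)).
  by rewrite -lead_coefM -rmorphM -PE -(dvdpZr _ _ lg) -lP dvdp_mulr.
have e1 : cone K u * cone K A + cone K v * cone K B = 1.
  by rewrite -!rmorphM -rmorphD -e rmorph1.
move: slP; rewrite PE rmorphM; move: e1 lcop sA sB.
move: (in_cone_cone A) (in_cone_cone B) (in_cone_cone u) (in_cone_cone v).
move: (cone K A) (cone K B) (cone K u) (cone K v) => a b w z.
move=> ca cb cw cz e1 lcop sa sb sab.
have [||sla slb] := size_lead_coef_in_coneM ca cb _ _ sab.
- by rewrite -size_poly_gt0 ltnW.
- by rewrite -size_poly_gt0 ltnW.
exact: cone_bezout_neq1 ca cb cw cz lcop sla slb sa sb e1.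
Qed.

(** * Roots of unity in a finite subfield *)

(** Over F, X^q - X is the product of all X - x, so its roots in K are images of elements of F. *)
Lemma fixed_frobenius_in_image (F : finFieldType) (K : fieldType)
    (j : {rmorphism F -> K}) (z : K) :
  z ^+ #|F| = z -> exists x, j x = z.
Proof.
move=> zq.
have := congr1 (fun p => (map_poly j p).[z]) (finField_genPoly F).
rewrite rmorphB rmorph_prod /= map_polyXn map_polyX hornerD hornerN.
rewrite hornerXn hornerX zq subrr horner_prod => /esym/eqP/prodf_eq0 [x _].
rewrite rmorphB /= map_polyX map_polyC hornerXsubC subr_eq0 => /eqP ->.
by exists x.
Qed.

Lemma unity_root_in_image (F : finFieldType) (K : fieldType)
    (j : {rmorphism F -> K}) (n : nat) (z : K) :
  (n %| #|F| - 1)%N -> z ^+ n = 1 -> exists x, j x = z.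
Proof.
move=> /dvdnP [k kE] zn; apply: fixed_frobenius_in_image.
have F1 : (0 < #|F|)%N by rewrite ltnW // finNzRing_gt1.
by rewrite -(subnK F1) kE addn1 exprS mulnC exprM zn expr1n mulr1.
Qed.

(** * Critical points of (X+1)^d - c X^d *)

Definition curve_poly (R : nzRingType) (d : nat) (c : R) : {poly R} :=
  ('X + 1) ^+ d - c *: 'X^d.

Lemma size_curve_poly (K : fieldType) (d : nat) (c : K) :
  (0 < d)%N -> c != 1 -> size (curve_poly d c) = d.+1.
Proof.
move=> d0 c1; rewrite /curve_poly.
have mX : ('X + 1 : {poly K}) ^+ d \is monic.
  by rewrite monic_exp // -polyC1 monicXaddC.
have sX : size (('X + 1 : {poly K}) ^+ d) = d.+1.
  by rewrite -polyC1 -(opprK 1%:P) -polyCN size_exp_XsubC.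
apply/eqP; rewrite eqn_leq; apply/andP; split.
  rewrite (leq_trans (size_polyD _ _)) // size_polyN geq_max sX leqnn /=.
  by rewrite (leq_trans (size_scale_leq _ _)) // size_polyXn.
rewrite ltnNge; apply/negP => /leq_sizeP /(_ d (leqnn d)) /eqP.
have -> : (('X + 1) ^+ d - c *: 'X^d)`_d = 1 - c.
  rewrite coefB coefZ coefXn eqxx mulr1; congr (_ - _).
  by move/monicP: mX; rewrite lead_coefE sX.
by rewrite subr_eq0 eq_sym (negPf c1).
Qed.

Lemma deriv_curve_poly (K : fieldType) (d : nat) (c : K) :
  (curve_poly d c)^`() = d%:R *: curve_poly d.-1 c.
Proof.
rewrite /curve_poly derivB derivZ derivXn deriv_exp derivD derivX -polyC1 derivC.
by rewrite addr0 mul1r -scalerMnr -mulrnBl -scaler_nat.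
Qed.

Lemma root_deriv_curve_poly (K : fieldType) (d : nat) (c x : K) :
  d%:R != 0 :> K ->
  root (curve_poly d c)^`() x = ((x + 1) ^+ d.-1 == c * x ^+ d.-1).
Proof.
move=> d0; rewrite deriv_curve_poly rootZ // /root /curve_poly.
by rewrite !hornerE subr_eq0.
Qed.

(** At a multiple critical point (x+1)^k = c x^k for both k = n and k = n+1; subtracting x times the
    first relation from the second gives (x+1)^n = 0, then x^n = 0, which is absurd. *)
Lemma curve_poly_simple (K : fieldType) (n : nat) (c x : K) :
  n.+2%:R != 0 :> K -> n.+1%:R != 0 :> K -> c != 0 ->
  root (curve_poly n.+2 c)^`() x -> ~~ root (curve_poly n.+2 c)^`()^`() x.
Proof.
move=> d0 n0 c0; rewrite root_deriv_curve_poly //= => /eqP e.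
rewrite deriv_curve_poly derivZ rootZ // root_deriv_curve_poly //=.
apply/negP => /eqP e'.
have x1 : (x + 1) ^+ n = 0.
  have -> : (x + 1) ^+ n = (x + 1) ^+ n.+1 - x * (x + 1) ^+ n.
    by rewrite exprS; ring.
  by rewrite e e' exprS; ring.
have xn : x ^+ n = 0.
  by apply/eqP; move/esym/eqP: e'; rewrite x1 mulf_eq0 (negPf c0).
case: n {d0 n0 e e'} x1 xn => [/eqP|n]; first by rewrite expr0 oner_eq0.
move=> /eqP + /eqP; rewrite !expf_eq0 /= => /eqP + /eqP x0.
by rewrite x0 add0r => /eqP; rewrite oner_eq0.
Qed.

Lemma curve_poly_crit_inj (F : finFieldType) (K : fieldType)
    (j : {rmorphism F -> K}) (n : nat) (c c0 x y : K) :
  (0 < n)%N -> n.+1%:R != 0 :> K -> (n %| #|F| - 1)%N -> c0 ^+ n = c ->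
  (forall z, j z <> c0) ->
  root (curve_poly n.+1 c)^`() x -> root (curve_poly n.+1 c)^`() y ->
  (curve_poly n.+1 c).[x] = (curve_poly n.+1 c).[y] -> x = y.
Proof.
move=> n0 d0 nF cE c0F; rewrite !root_deriv_curve_poly //= => /eqP ex /eqP ey.
have c00 : c0 != 0 by apply/eqP => c00; apply: (c0F 0); rewrite rmorph0.
have cn0 : c != 0 by rewrite -cE expf_neq0.
have crit_neq0 z : (z + 1) ^+ n = c * z ^+ n -> z != 0 /\ z + 1 != 0.
  move=> e; have z0 : z != 0.
    apply/eqP => z0; move/eqP: e.
    by rewrite z0 add0r expr1n expr0n gtn_eqF // mulr0 oner_eq0.
  by split=> //; move: (expf_neq0 n z0); apply: contraNneq => z1;
    move/esym/eqP: e; rewrite z1 expr0n gtn_eqF // mulf_eq0 (negPf cn0).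
have [x0 x1] := crit_neq0 x ex; have [y0 y1] := crit_neq0 y ey.
have gE z : (z + 1) ^+ n = c * z ^+ n -> (curve_poly n.+1 c).[z] = c * z ^+ n.
  by move=> e; rewrite /curve_poly !hornerE exprS e exprS; ring.
rewrite !gE // => /(mulfI cn0) exy.
(* Equal critical values give x^n = y^n, and then (x+1)^n = (y+1)^n, so both ratios are n-th roots
   of unity. *)
have [|a aE] := @unity_root_in_image F K j n (y / x) nF.
  by rewrite expr_div_n exy divff // -exy expf_neq0.
have [|b bE] := @unity_root_in_image F K j n ((y + 1) / (x + 1)) nF.
  by rewrite expr_div_n ex ey exy divff // mulf_neq0 // expf_neq0.
have yE : y = j a * x by rewrite aE divfK.
have y1E : y + 1 = j b * (x + 1) by rewrite bE divfK.
have key : x * (j a - j b) = j b - 1.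
  have -> : x * (j a - j b) = (j a * x + 1) - j b * (x + 1) + j b - 1 by ring.
  by rewrite -yE y1E subrr add0r.
have [ab|ab] := eqVneq a b.
  move: key; rewrite ab subrr mulr0 => /esym/eqP; rewrite subr_eq0 => /eqP b1.
  by rewrite yE ab b1 mul1r.
have jab : j a - j b != 0 by rewrite -rmorphB fmorph_eq0 subr_eq0.
pose w := (b - 1) / (a - b).
have xE : x = j w by rewrite fmorph_div !rmorphB rmorph1 -key mulfK.
(* Since (x+1)^n = (c0 x)^n, this ratio is also in the image of F; with x there, c0 would be there
   too. *)
have [|e eE] := @unity_root_in_image F K j n (c0 * x / (x + 1)) nF.
  by rewrite expr_div_n exprMn cE ex divff // -ex expf_neq0.
case: (c0F (e * (w + 1) / w)).
by rewrite fmorph_div rmorphM rmorphD rmorph1 -xE eE divfK // mulfK.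
Qed.

(** * The curve over the algebraic closure *)

Lemma curve_eq_uni (F : fieldType) (K : fieldType) (iota : {rmorphism F -> K})
    (d : nat) (c : F) (P : {mpoly F[2]}) :
  curve_eq d c P ->
  map_mpoly iota P * ('X_0 - 'X_1) =
    uni 0 (curve_poly d (iota c)) - uni 1 (curve_poly d (iota c)).
Proof.
move=> /(congr1 (map_mpoly iota)).
rewrite rmorphM rmorphB /= !map_mpolyX => ->.
rewrite /curve_num /curve_poly -!mul_mpolyC -!mul_polyC.
rewrite !(rmorphB, rmorphD, rmorphM, rmorphXn, rmorph1) /= !map_mpolyX map_mpolyC.
by rewrite !uniC !uniX; ring.
Qed.

(* F is F_q, Fbar its algebraic closure (via iota), and Fs, embedded in Fbar
   via j, is the subfield F_{p^s} of Fbar. *)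
Theorem theorem4p2
  (p h d s : nat)
  (p_prime : prime p)
  (F : finFieldType) (card_F : #|F| = (p ^ h)%N)
  (c : F)
  (d_gt0 : (0 < d)%N)
  (p_ndvd : ~~ (p %| d * (d - 1))%N)
  (s_gt0 : (0 < s)%N)
  (s_dvd : (d - 1 %| p ^ s - 1)%N)
  (s_min : forall t : nat, (0 < t)%N -> (d - 1 %| p ^ t - 1)%N -> (s <= t)%N)
  (Fbar : closedFieldType) (iota : {rmorphism F -> Fbar})
  (Fbar_closure : algebraic_closure iota)
  (Fs : finFieldType) (card_Fs : #|Fs| = (p ^ s)%N)
  (j : {rmorphism Fs -> Fbar})
  (c0 : Fbar) (c0_root : c0 ^+ (d - 1) = iota c)
  (c0_notin : forall x : Fs, j x <> c0)
  (P : {mpoly F[2]}) (P_curve : curve_eq d c P) :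
  absolutely_irreducible iota P.
Proof.
have pcharK : p \in [pchar Fbar].
  by rewrite (fmorph_pchar j); apply: card_finPcharP card_Fs p_prime.
(* For d = 1 the product d (d - 1) is 0, which p divides. *)
have [n dE] : exists n, d = n.+2.
  move: d_gt0 p_ndvd; case: (d) => [|[|n]] //; last by exists n.
  by rewrite subnn muln0 dvdn0.
subst d; move: p_ndvd s_dvd c0_root P_curve; rewrite subn1 /= -card_Fs.
rewrite Euclid_dvdM // negb_or !(dvdn_pcharf pcharK) => /andP[d0 n0] nF c0E.
move=> /(curve_eq_uni iota) PE.
(* Otherwise c0 would be a (d-1)-th root of unity, hence in F_{p^s}. This keeps the degree of g
   equal to d. *)
have c1 : iota c != 1.
  apply/eqP => c1; have [|x xE] := @unity_root_in_image Fs Fbar j n.+1 c0 nF.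
    by rewrite c0E.
  exact: (c0_notin x).
have c_neq0 : iota c != 0.
  rewrite -c0E expf_neq0 //; apply/eqP => c00.
  by apply: (c0_notin 0); rewrite rmorph0.
apply: (morse_irreducible PE).
- by rewrite size_curve_poly.
- by rewrite size_curve_poly.
- by move=> x; apply: curve_poly_simple.
- by move=> x y; apply: (curve_poly_crit_inj _ d0 nF c0E c0_notin).
Qed.
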